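(* The variety $\mathfrak B_{\rm sup}$ of all bicommutative superalgebras over any field of characteristic different from $2$ satisfies the Specht property, i.e. every variety of bicommutative superalgebras can be defined by a finite number of super-identities.
   Context: Algebras are not assumed associative or unital. A superalgebra is an algebra $A=A_0\oplus A_1$ with $A_iA_j\subseteq A_{i+j\,(\mathrm{mod}\,2)}$; for $a\in A_i$ write $\overline a=i$. A superalgebra is bicommutative if for all homogeneous elements $x_1(x_2x_3)=(-1)^{\overline{x_1}\,\overline{x_2}}x_2(x_1x_3)$ and $(x_1x_2)x_3=(-1)^{\overline{x_2}\,\overline{x_3}}(x_1x_3)x_2$. A super-identity is an element $f(Y,Z)$ of the free (nonassociative) superalgebra on countably many even generators $Y=\{y_1,y_2,\dots\}$ and odd generators $Z=\{z_1,z_2,\dots\}$; a superalgebra $A$ satisfies it if $f$ vanishes under every substitution of elements of $A_0$ for the $y_i$ and of elements of $A_1$ for the $z_j$. A variety of superalgebras is the class of all superalgebras satisfying a given set of super-identities; a variety of bicommutative superalgebras is a variety contained in $\mathfrak B_{\rm sup}$. *)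

(* Defs.v *)
From HB Require Import structures.
From mathcomp Require Import all_boot all_order all_algebra.
From mathcomp Require Import finmap.
From mathcomp.multinomials Require Import monalg.

Set Implicit Arguments.
Unset Strict Implicit.
Unset Printing Implicit Defensive.

Import GRing.Theory.
Local Open Scope ring_scope.

(* Parities are booleans: [false] is even, [true] is odd, and addition mod 2  *)
(* is [addb].  The homogeneous components are Prop-valued, so that arbitrary  *)
(* (not only decidable) subspaces are allowed.                                *)
Record superalgebra (K : fieldType) := Superalgebra {
  carrier :> lmodType K;
  smul : {bilinear carrier -> carrier -> carrier};
  homog : bool -> carrier -> Prop;
  homog0 : forall i, homog i 0;
  homogD : forall i a b, homog i a -> homog i b -> homog i (a + b);
  homogZ : forall i (c : K) a, homog i a -> homog i (c *: a);
  homog_decomp : forall a, exists a0 a1,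
    [/\ homog false a0, homog true a1 & a = a0 + a1];
  homog_direct : forall a, homog false a -> homog true a -> a = 0;
  homogM : forall i j a b,
    homog i a -> homog j b -> homog (i (+) j) (smul a b)
}.

Arguments smul {K s}.
Arguments homog {K s}.

Definition bicommutative (K : fieldType) (A : superalgebra K) : Prop :=
  forall (i j k : bool) (x1 x2 x3 : A),
    homog i x1 -> homog j x2 -> homog k x3 ->
    smul x1 (smul x2 x3) = (-1) ^+ (i && j) *: smul x2 (smul x1 x3) /\
    smul (smul x1 x2) x3 = (-1) ^+ (j && k) *: smul (smul x1 x3) x2.

Inductive magma (X : Type) := Leaf of X | Node of magma X & magma X.

Fixpoint magma_encode X (t : magma X) : GenTree.tree X :=
  match t with
  | Leaf x => GenTree.Leaf x
  | Node u v => GenTree.Node 0 [:: magma_encode u; magma_encode v]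
  end.

Fixpoint magma_decode X (t : GenTree.tree X) : option (magma X) :=
  match t with
  | GenTree.Leaf x => Some (Leaf x)
  | GenTree.Node _ [:: u; v] =>
      if (magma_decode u, magma_decode v) is (Some u', Some v')
      then Some (Node u' v') else None
  | _ => None
  end.

Lemma magma_encodeK X : pcancel (@magma_encode X) (@magma_decode X).
Proof. by elim=> //= u -> v ->. Qed.

HB.instance Definition _ (X : choiceType) :=
  Choice.copy (magma X) (pcan_type (@magma_encodeK X)).

(* [(false, n)] is the even generator y_n, [(true, n)] the odd one z_n.       *)
Definition generator : choiceType := (bool * nat)%type.

Fixpoint parity (t : magma generator) : bool :=
  match t with
  | Leaf x => x.1
  | Node u v => parity u (+) parity v
  end.

Section LinearExtension.
Variables (K : fieldType) (M : choiceType) (V : lmodType K).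

Definition linext (h : M -> V) (f : {malg K[M]}) : V :=
  \sum_(t <- msupp f) f@_t *: h t.

Lemma linextEw (d : {fset M}) h f : (msupp f `<=` d)%fset ->
  linext h f = \sum_(t <- d) f@_t *: h t.
Proof.
move=> le; rewrite /linext (big_fset_incl _ le) // => t _ /mcoeff_outdom ->.
by rewrite scale0r.
Qed.

Lemma linext_linear h : linear (linext h).
Proof.
move=> c f g; pose d := (msupp f `|` msupp g)%fset.
have lef : (msupp f `<=` d)%fset by apply: fsubsetUl.
have leg : (msupp g `<=` d)%fset by apply: fsubsetUr.
have lefg : (msupp (c *: f + g) `<=` d)%fset.
  apply: fsubset_trans (msuppD_le _ _) _; rewrite fsubUset leg andbT.
  exact: fsubset_trans (msuppZ_le _ _) lef.
rewrite (linextEw _ lef) (linextEw _ leg) (linextEw _ lefg) scaler_sumr -big_split.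
by apply: eq_bigr => t _; rewrite /= mcoeffD mcoeffZ scalerDl scalerA.
Qed.

HB.instance Definition _ h :=
  GRing.isLinear.Build K {malg K[M]} V _ (linext h) (linext_linear h).

Lemma linextU h c t : linext h << c *g t >> = c *: h t.
Proof.
by rewrite (linextEw _ msuppU_le) big_seq_fset1 mcoeffUU.
Qed.

Lemma eq_linext h1 h2 f : h1 =1 h2 -> linext h1 f = linext h2 f.
Proof. by move=> eqh; apply: eq_bigr => t _; rewrite eqh. Qed.

Lemma linext_fun_linear (c : K) (h1 h2 : M -> V) f :
  linext (fun t => c *: h1 t + h2 t) f = c *: linext h1 f + linext h2 f.
Proof.
rewrite /linext scaler_sumr -big_split; apply: eq_bigr => t _ /=.
by rewrite scalerDr !scalerA mulrC.
Qed.

End LinearExtension.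

Lemma linear_linext (K : fieldType) (M : choiceType) (V W : lmodType K)
    (L : {linear V -> W}) (h : M -> V) (f : {malg K[M]}) :
  L (linext h f) = linext (fun t => L (h t)) f.
Proof. by rewrite linear_sum; apply: eq_bigr => t _; rewrite linearZ_LR. Qed.

HB.lock Definition free_mul (K : fieldType) (f g : {malg K[magma generator]}) :
    {malg K[magma generator]} :=
  linext (fun u => linext (fun v => << Node u v >>) g) f.

Section FreeSuperalgebra.
Variable K : fieldType.

Local Notation F := {malg K[magma generator]}.

Lemma free_mul_bilinear : bilinear_for *:%R *:%R (@free_mul K).
Proof.
rewrite unlock; split=> [g c f1 f2 | f c g1 g2] /=; first exact: linext_linear.
rewrite -[RHS]linext_fun_linear; apply: eq_linext => u.
exact: linext_linear.
Qed.

HB.instance Definition _ :=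
  bilinear_isBilinear.Build K F F F *:%R *:%R (@free_mul K)
    free_mul_bilinear.

Lemma free_mulU u v : @free_mul K << u >> << v >> = << Node u v >>.
Proof. by rewrite unlock !linextU !scale1r. Qed.

Definition free_homog (i : bool) (f : F) : Prop :=
  forall t, t \in msupp f -> parity t = i.

Lemma free_homogP i f :
  free_homog i f <-> forall t, parity t != i -> f@_t = 0.
Proof.
split=> [hf t nt | hf t].
  by apply: mcoeff_outdom; apply: contra nt => /hf ->.
by rewrite -mcoeff_neq0; apply: contraNeq => /hf ->.
Qed.

Lemma free_homog0 i : free_homog i 0.
Proof. by apply/free_homogP => t _; rewrite mcoeff0. Qed.

Lemma free_homogD i f g :
  free_homog i f -> free_homog i g -> free_homog i (f + g).
Proof.
move=> /free_homogP hf /free_homogP hg; apply/free_homogP => t nt.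
by rewrite mcoeffD hf // hg // addr0.
Qed.

Lemma free_homogZ i (c : K) f : free_homog i f -> free_homog i (c *: f).
Proof.
by move=> /free_homogP hf; apply/free_homogP => t nt; rewrite mcoeffZ hf ?mulr0.
Qed.

Lemma free_homogU t : free_homog (parity t) << t >>.
Proof. by move=> u; rewrite msuppU oner_eq0 inE => /eqP ->. Qed.

Lemma free_homog_sum i (s : seq (magma generator)) (P : pred (magma generator))
    (G : magma generator -> F) :
  (forall t, t \in s -> P t -> free_homog i (G t)) ->
  free_homog i (\sum_(t <- s | P t) G t).
Proof.
move=> hG; rewrite big_seq_cond; apply: (big_ind (free_homog i)).
- exact: free_homog0.
- exact: free_homogD.
- by move=> t /andP[]; apply: hG.
Qed.

Lemma free_homog_decomp f : exists f0 f1,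
  [/\ free_homog false f0, free_homog true f1 & f = f0 + f1].
Proof.
exists (\sum_(t <- msupp f | ~~ parity t) << f@_t *g t >>).
exists (\sum_(t <- msupp f | parity t) << f@_t *g t >>).
split; last by rewrite addrC [LHS]monalgE (bigID parity).
- apply: free_homog_sum => t _ /negbTE pt; apply/free_homogP => u pu.
  by rewrite mcoeffU; have [tu|//] := eqVneq t u; rewrite -tu pt in pu.
- apply: free_homog_sum => t _ pt; apply/free_homogP => u pu.
  by rewrite mcoeffU; have [tu|//] := eqVneq t u; rewrite -tu pt in pu.
Qed.

Lemma free_homog_direct f : free_homog false f -> free_homog true f -> f = 0.
Proof.
move=> /free_homogP h0 /free_homogP h1; apply/malgP => t; rewrite mcoeff0.
by case pt: (parity t); [apply: h0 | apply: h1]; rewrite pt.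
Qed.

Lemma free_homogM i j f g :
  free_homog i f -> free_homog j g -> free_homog (i (+) j) (free_mul f g).
Proof.
move=> hf hg; rewrite unlock; apply: free_homog_sum => u uf _; apply: free_homogZ.
apply: free_homog_sum => v vg _; apply: free_homogZ.
by rewrite -(hf u uf) -(hg v vg); exact (@free_homogU (Node u v)).
Qed.

Definition free_superalgebra : superalgebra K :=
  @Superalgebra K F (@free_mul K) free_homog free_homog0 free_homogD free_homogZ
    free_homog_decomp free_homog_direct free_homogM.

End FreeSuperalgebra.

Definition super_identity (K : fieldType) : Type := free_superalgebra K.

Definition gen (K : fieldType) (x : generator) : super_identity K :=
  << Leaf x >>.
Arguments gen : clear implicits.

Section Evaluation.
Variables (K : fieldType) (A : superalgebra K).

Fixpoint eval_monomial (phi : generator -> A) (t : magma generator) : A :=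
  match t with
  | Leaf x => phi x
  | Node u v => smul (eval_monomial phi u) (eval_monomial phi v)
  end.

Definition eval (phi : generator -> A) (f : super_identity K) : A :=
  linext (eval_monomial phi) f.

Definition satisfies (f : super_identity K) : Prop :=
  forall phi : generator -> A,
    (forall x, homog x.1 (phi x)) -> eval phi f = 0.

Lemma eval_linear phi : linear (eval phi).
Proof. exact: linext_linear. Qed.

Lemma evalB phi f g : eval phi (f - g) = eval phi f - eval phi g.
Proof. exact: (raddfB (linext (eval_monomial phi))). Qed.

Lemma evalZ phi c f : eval phi (c *: f) = c *: eval phi f.
Proof. exact: (linearZ_LR (linext (eval_monomial phi))). Qed.

Lemma eval_gen phi x : eval phi (gen K x) = phi x.
Proof. by rewrite /eval linextU scale1r. Qed.

Lemma evalM phi f g : eval phi (smul f g) = smul (eval phi f) (eval phi g).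
Proof.
have -> : smul (eval phi f) (eval phi g) =
    linext (fun u => smul (eval_monomial phi u) (eval phi g)) f.
  rewrite /eval {1}/linext linear_sumlz.
  by apply: eq_bigr => u _; rewrite linearZl_LR.
rewrite /eval (_ : smul f g = free_mul f g) // unlock linear_linext.
apply: eq_linext => u.
rewrite /eval !linear_linext; apply: eq_linext => v.
by rewrite /= linextU scale1r.
Qed.

End Evaluation.

Definition variety_of (K : fieldType) (S : super_identity K -> Prop) :
  superalgebra K -> Prop :=
  fun A => forall f, S f -> satisfies A f.

Definition is_variety (K : fieldType) (V : superalgebra K -> Prop) : Prop :=
  exists S : super_identity K -> Prop, forall A, V A <-> variety_of S A.

Definition finitely_based (K : fieldType) (V : superalgebra K -> Prop) : Prop :=
  exists s : seq (super_identity K), forall A, V A <-> variety_of (fun f => f \in s) A.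

Definition specht_property (K : fieldType) (B : superalgebra K -> Prop) : Prop :=
  forall V : superalgebra K -> Prop,
    is_variety V -> (forall A, V A -> B A) -> finitely_based V.

Section BicommutativeVariety.
Variable K : fieldType.

Definition left_bicomm_identity (i j k : bool) : super_identity K :=
  let: (x1, x2, x3) := (gen K (i, 0), gen K (j, 1), gen K (k, 2)) in
  smul x1 (smul x2 x3) - (-1) ^+ (i && j) *: smul x2 (smul x1 x3).

Definition right_bicomm_identity (i j k : bool) : super_identity K :=
  let: (x1, x2, x3) := (gen K (i, 0), gen K (j, 1), gen K (k, 2)) in
  smul (smul x1 x2) x3 - (-1) ^+ (j && k) *: smul (smul x1 x3) x2.

Lemma eval_left_bicomm (A : superalgebra K) (phi : generator -> A) i j k :
  eval phi (left_bicomm_identity i j k) =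
  smul (phi (i, 0)) (smul (phi (j, 1)) (phi (k, 2))) -
  (-1) ^+ (i && j) *: smul (phi (j, 1)) (smul (phi (i, 0)) (phi (k, 2))).
Proof.
rewrite -(eval_gen phi (i, 0)) -(eval_gen phi (j, 1)) -(eval_gen phi (k, 2)).
rewrite /left_bicomm_identity.
move: (gen K (i, 0)) (gen K (j, 1)) (gen K (k, 2)) => x y z.
by rewrite evalB evalZ !evalM.
Qed.

Lemma eval_right_bicomm (A : superalgebra K) (phi : generator -> A) i j k :
  eval phi (right_bicomm_identity i j k) =
  smul (smul (phi (i, 0)) (phi (j, 1))) (phi (k, 2)) -
  (-1) ^+ (j && k) *: smul (smul (phi (i, 0)) (phi (k, 2))) (phi (j, 1)).
Proof.
rewrite -(eval_gen phi (i, 0)) -(eval_gen phi (j, 1)) -(eval_gen phi (k, 2)).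
rewrite /right_bicomm_identity.
move: (gen K (i, 0)) (gen K (j, 1)) (gen K (k, 2)) => x y z.
by rewrite evalB evalZ !evalM.
Qed.

Lemma bicommutative_is_variety : is_variety (@bicommutative K).
Proof.
exists (fun f => exists i j k,
  f = left_bicomm_identity i j k \/ f = right_bicomm_identity i j k) => A.
split=> [bA f [i [j [k Hf]]] phi hphi | sA i j k x1 x2 x3 h1 h2 h3].
  have [e1 e2] := bA i j k _ _ _ (hphi (i, 0)) (hphi (j, 1)) (hphi (k, 2)).
  case: Hf => ->.
    by rewrite eval_left_bicomm e1 subrr.
  by rewrite eval_right_bicomm e2 subrr.
pose phi (x : generator) : A :=
  if x.2 is n.+1 then (if n is 0 then x2 else x3) else x1.
have {}sA f : (f = left_bicomm_identity i j k \/ f = right_bicomm_identity i j k) ->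
    eval (fun x => if (x == (i, 0)) || (x == (j, 1)) || (x == (k, 2))
                   then phi x else 0) f = 0.
  move=> Hf; apply: sA; first by exists i, j, k.
  move=> x; case: ifP => [|_]; last exact: homog0.
  by case/orP=> [/orP[]|] /eqP ->.
split; apply: subr0_eq.
- by have := sA _ (or_introl erefl); rewrite eval_left_bicomm !eqxx ?orbT.
- by have := sA _ (or_intror erefl); rewrite eval_right_bicomm !eqxx ?orbT.
Qed.

End BicommutativeVariety.

(* Main.v *)
Require Import Defs.
From mathcomp Require Import all_boot all_order all_algebra.
From mathcomp Require Import finmap.
From mathcomp.multinomials Require Import monalg.
From mathcomp Require Import boolp zify.

(** In a bicommutative superalgebra, left multiplications commute with each
other up to sign, and so do right multiplications. On products, left and right
multiplications also commute. Consequently a nonassociative monomial of degree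
at least two is determined, up to a nonzero scalar, by two multisets: the
generators sitting at left children of its tree and those sitting at right
children ([straightening]). Monomials thus behave like commutative monomials in
variables that come in infinitely many blocks, one block per index [i], each of
bounded size: the two generators of index [i], as left, right or sole leaf.

A variety of bicommutative superalgebras is given by its set [I] of identities.
This set is closed under linear combinations, under multiplication by a
generator, and under renaming the indices along an increasing map. Order the
monomials by the largest variable whose exponents differ; this is a well-founded
total order, up to proportionality, compatible with these operations. So if the
leading monomial of some [f] in [I] divides [t] after an increasing renaming,
some consequence of [f] has leading monomial [t] ([lead_transfer]). By Higman's
lemma, finitely many leading monomials of elements of [I] divide all the others
in this sense ([le_code_finite_basis]). As in the Hilbert basis theorem of
Groebner theory, subtracting consequences of the corresponding finitely many
identities lowers the leading monomial until nothing is left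
([lead_reduction]). Together with the bicommutative identities themselves, these
finitely many identities define the variety. *)

Set Implicit Arguments.
Unset Strict Implicit.
Unset Printing Implicit Defensive.

Import GRing.Theory.

(** * Higman's lemma *)

Definition increasing (s : nat -> nat) := {homo s : i j / i < j}.

Lemma increasing_comp s1 s2 :
  increasing s1 -> increasing s2 -> increasing (s1 \o s2).
Proof. by move=> inc1 inc2 i j /inc2 /inc1. Qed.

(** Higman's lemma is proved by Nash-Williams' minimal bad sequence argument. The
hypothesis on letters, that every sequence has an ascending subsequence, is
what lets first letters be compared and tails be extracted simultaneously. *)
Section Higman.
Variables (X : Type) (leX : X -> X -> Prop).

Inductive embed : seq X -> seq X -> Prop :=
| embed_nil v : embed [::] v
| embed_skip y u v : embed u v -> embed u (y :: v)
| embed_cons x y u v : leX x y -> embed u v -> embed (x :: u) (y :: v).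

Lemma embed_increasing x0 u v : embed u v ->
  exists2 s, increasing s &
    forall i, i < size u -> leX (nth x0 u i) (nth x0 v (s i)).
Proof.
elim=> {u v} [v | y u v _ [s incs les] | x y u v lexy _ [s incs les]].
- by exists id.
- by exists (fun i => (s i).+1) => // i j /incs.
exists (fun i => if i is i'.+1 then (s i').+1 else 0).
  by move=> [|i] [|j] //= lt_ij; apply: incs.
by case=> [|i] //= /les.
Qed.

Definition good T (le : T -> T -> Prop) (f : nat -> T) :=
  exists i j, i < j /\ le (f i) (f j).

Hypothesis mono_leX : forall f : nat -> X, exists2 s, increasing s &
  forall i j, i < j -> leX (f (s i)) (f (s j)).

Definition bad_prefix (p : seq (seq X)) := exists2 f,
  ~ good embed f & forall i, i < size p -> f i = nth [::] p i.

(** One step of the greedy construction of a bad sequence that is minimal for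
the lexicographic comparison of word lengths. *)
Lemma minimal_extension p : exists w, bad_prefix p ->
  bad_prefix (rcons p w) /\
  forall w', bad_prefix (rcons p w') -> size w <= size w'.
Proof.
have [badp | nbad] := EM (bad_prefix p); last by exists [::].
pose has_size n := `[< exists2 w, bad_prefix (rcons p w) & size w = n >].
have ex_n : exists n, has_size n.
  have [f badf fp] := badp; exists (size (f (size p))).
  apply/asboolP; exists (f (size p)) => //; exists f => // i.
  rewrite size_rcons ltnS nth_rcons leq_eqVlt.
  by case: ltngtP => //= [/fp | ->].
case: (ex_minnP ex_n) => n /asboolP[w badw sz_w] min_n.
exists w => _; split=> // w' badw'.
by rewrite sz_w; apply: min_n; apply/asboolP; exists w'.
Qed.

(** In a minimal bad sequence every word is nonempty. Along a subsequence with
ascending first letters, an embedding between tails would give one between the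
words, so the tails are bad too: this contradicts minimality. *)
Theorem higman (f : nat -> seq X) : good embed f.
Proof.
apply: contrapT => badf.
have [step stepP] := choice minimal_extension.
pose pre := fix pre n :=
  if n is n'.+1 then rcons (pre n') (step (pre n')) else [::].
pose m n := step (pre n).
have sz_pre n : size (pre n) = n by elim: n => //= n IH; rewrite size_rcons IH.
have nth_pre n i : i < n -> nth [::] (pre n) i = m i.
  elim: n => //= n IH; rewrite nth_rcons sz_pre ltnS leq_eqVlt.
  by case: ltngtP => //= [/IH | ->].
have bad_pre n : bad_prefix (pre n).
  by elim: n => [|n /stepP[]//]; exists f.
have badm : ~ good embed m.
  case=> i [j [ij eij]]; have [g badg gP] := bad_pre j.+1.
  apply: badg; exists i, j; split=> //.
  by rewrite !gP ?sz_pre ?nth_pre // ltnS ltnW.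
have mne n : exists x w, m n = x :: w.
  case m_n: (m n) => [|x w]; last by exists x, w.
  by case: badm; exists n, n.+1; rewrite m_n; split=> //; apply: embed_nil.
have [hd hdP] := choice mne; have [tl tlP] := choice hdP.
have [s incs les] := mono_leX hd.
(* The tails along the subsequence continue the prefix of length [s 0] by a
   bad sequence whose next word is too short. *)
pose g n := if n < s 0 then m n else tl (s (n - s 0)).
have s0le n : s 0 <= s n by case: n => // n; apply/ltnW/incs.
have badg : ~ good embed g.
  case=> i [j [ij]]; rewrite /g; case: ltnP => [i0 | i0].
    case: ltnP => j0 eij; first by apply: badm; exists i, j.
    apply: badm; exists i, (s (j - s 0)); split; first exact: leq_trans (s0le _).
    by rewrite (tlP (s _)); apply: embed_skip.
  rewrite ltnNge (leq_trans i0 (ltnW ij)) /= => eij.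
  have ij' : i - s 0 < j - s 0 by lia.
  apply: badm; exists (s (i - s 0)), (s (j - s 0)); split; first exact: incs.
  by rewrite !tlP; apply: embed_cons eij; apply: les.
have [_ /(_ (tl (s 0)))] := stepP _ (bad_pre (s 0)).
rewrite -/(m (s 0)) tlP /= ltnn => no_shorter.
suff /no_shorter : bad_prefix (rcons (pre (s 0)) (tl (s 0))) by [].
exists g => // i.
rewrite size_rcons sz_pre ltnS nth_rcons sz_pre /g => le_i.
by case: ltngtP le_i => // [/nth_pre -> // | ->]; rewrite subnn.
Qed.

End Higman.

(** * Vectors of natural numbers *)

Lemma nat_increasing_subseq (f : nat -> nat) : exists2 s, increasing s &
  forall i j, i < j -> f (s i) <= f (s j).
Proof.
have min_from n : exists k, n <= k /\ forall j, n <= j -> f k <= f j.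
  pose P v := `[< exists2 k, n <= k & f k = v >].
  have exP : exists v, P v by exists (f n); apply/asboolP; exists n.
  case: (ex_minnP exP) => v /asboolP[k le_nk <-] minv; exists k; split=> // j le_nj.
  by apply: minv; apply/asboolP; exists j.
have [g gP] := choice min_from.
pose s := fix s n := if n is n'.+1 then g (s n').+1 else g 0.
have incs : increasing s.
  by apply: homo_ltn => [y x z|i]; [apply: ltn_trans | have [] := gP (s i).+1].
exists s => // i j /incs lt_s.
case: i lt_s => [|i] lt_s; first by have [_] := gP 0; apply.
have [le_i] := gP (s i).+1; apply; exact: leq_trans le_i (ltnW lt_s).
Qed.

Lemma vector_increasing_subseq n (f : nat -> nat -> nat) :
  exists2 s, increasing s &
    forall i j, i < j -> forall k, k < n -> f (s i) k <= f (s j) k.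
Proof.
elim: n => [|n [s incs IH]]; first by exists id.
have [t inct les] := nat_increasing_subseq (fun i => f (s i) n).
exists (s \o t); first exact: increasing_comp.
move=> i j ij k; rewrite ltnS leq_eqVlt => /orP[/eqP-> | ltk]; first exact: les.
by apply: IH ltk; apply: inct.
Qed.

(** * Divisibility of multisets up to an increasing renaming *)

(** A natural number [6 * i + r] stands for a variable of index [i] and kind [r];
[shift s] renames the indices and keeps the kinds. *)
Section Shift.
Variable s : nat -> nat.
Definition shift n := 6 * s (n %/ 6) + n %% 6.

Hypothesis incs : increasing s.

Lemma increasing_shift : increasing shift.
Proof.
move=> m n lt_mn; rewrite /shift.
have [q | q | q] := ltngtP (m %/ 6) (n %/ 6); last by rewrite q; lia.
  by have := incs q; lia.
by move: q lt_mn; lia.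
Qed.

Lemma shift_inj : injective shift.
Proof.
move=> m n eq_mn; have [/increasing_shift|/increasing_shift|//] := ltngtP m n.
  by rewrite eq_mn ltnn.
by rewrite eq_mn ltnn.
Qed.
End Shift.

Definition le_code (c c' : seq nat) := exists2 s, increasing s &
  forall n, count_mem n c <= count_mem (shift s n) c'.

Lemma mem_le_max (c : seq nat) n : n \in c -> n <= \max_(m <- c) m.
Proof. by move=> nc; apply: (@leq_bigmax_seq _ c xpredT id). Qed.

(** A multiset is read as the word of its blocks: the letter at [i] lists the
multiplicities of [6 * i + k] for [k < 6]. *)
Lemma le_code_good (f : nat -> seq nat) : good le_code f.
Proof.
pose block c i k := count_mem (6 * i + k) c.
pose word c := mkseq (block c) (\max_(n <- c) n).+1.
pose leB (x y : nat -> nat) := forall k, k < 6 -> x k <= y k.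
have mono_leB (g : nat -> nat -> nat) : exists2 s, increasing s &
    forall i j, i < j -> leB (g (s i)) (g (s j)).
  exact: vector_increasing_subseq.
have [i [j [ij eij]]] := higman mono_leB (word \o f).
exists i, j; split=> //.
have [s incs les] := embed_increasing (fun=> 0) eij; exists s => // n.
have [nin | nin] := boolP (n \in f i); last by rewrite (count_memPn nin).
have ltn : n %/ 6 < size (word (f i)).
  rewrite size_mkseq ltnS; apply: leq_trans (leq_div n 6) _.
  exact: mem_le_max.
have := les _ ltn (n %% 6); rewrite ltn_mod => /(_ isT) /=.
rewrite nth_mkseq; last by move: ltn; rewrite size_mkseq.
rewrite /block mulnC -divn_eq => /leq_trans; apply; rewrite /word.
have [lt_s | ge_s] := ltnP (s (n %/ 6)) (\max_(k <- f j) k).+1.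
  by rewrite nth_mkseq.
by rewrite nth_default // size_mkseq.
Qed.

(** Without a finite basis, choosing again and again an element that is above
none of the previous ones would produce a bad sequence. *)
Lemma le_code_finite_basis (T : eqType) (code : T -> seq nat) (P : T -> Prop) :
  exists2 s : seq T, (forall t, t \in s -> P t) &
    forall t, P t -> exists2 t0, t0 \in s & le_code (code t0) (code t).
Proof.
apply: contrapT => nobasis.
have new (s : seq T) : exists t, (forall t, t \in s -> P t) ->
    P t /\ forall t0, t0 \in s -> ~ le_code (code t0) (code t).
  apply: contrapT => /forallNP nonew; apply: nobasis; exists s.
    move=> t0 t0s; apply: contrapT => nPt0.
    by case: (nonew t0) => /(_ _ t0s).
  move=> t Pt; apply: contrapT => nle; case: (nonew t) => _; split=> // t0 t0s le.
  by apply: nle; exists t0.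
have [g gP] := choice new.
pose pre := fix pre n := if n is n'.+1 then g (pre n') :: pre n' else [::].
have preP n : forall t, t \in pre n -> P t.
  elim: n => //= n IH t; rewrite inE => /orP[/eqP -> | /IH //].
  by have [] := gP _ IH.
have pre_mem i j : i < j -> g (pre i) \in pre j.
  elim: j => //= j IH; rewrite ltnS inE leq_eqVlt => /orP[/eqP -> | /IH ->].
    by rewrite eqxx.
  by rewrite orbT.
have [i [j [ij le_ij]]] := le_code_good (code \o g \o pre).
by have [_ /(_ _ (pre_mem i j ij))] := gP _ (preP j).
Qed.

(** * The monomial order *)

(** The multiset extension of the usual order of the natural numbers. *)
Definition lt_code (c c' : seq nat) := exists2 n, count_mem n c < count_mem n c' &
  forall m, n < m -> count_mem m c = count_mem m c'.

Lemma lt_code_trans c2 c1 c3 : lt_code c1 c2 -> lt_code c2 c3 -> lt_code c1 c3.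
Proof.
move=> [n ltn eqn] [m ltm eqm]; exists (maxn n m) => [|k ltk]; last first.
  by rewrite eqn ?eqm //; lia.
case: (ltngtP n m) => [nm|mn|nm]; first by rewrite eqn.
  by rewrite -eqm.
by rewrite -nm in ltm; apply: ltn_trans ltm.
Qed.

Lemma lt_code_perml c1 c1' c2 : perm_eq c1 c1' -> lt_code c1 c2 -> lt_code c1' c2.
Proof.
move=> /permP eqc [n ltn eqn]; exists n; first by rewrite -eqc.
by move=> m /eqn; rewrite -eqc.
Qed.

Lemma lt_code_permr c1 c2 c2' : perm_eq c2 c2' -> lt_code c1 c2 -> lt_code c1 c2'.
Proof.
move=> /permP eqc [n ltn eqn]; exists n; first by rewrite -eqc.
by move=> m /eqn; rewrite -eqc.
Qed.

(** Above a common bound all multiplicities vanish; the bound is lowered until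
a difference appears. *)
Lemma lt_code_total c c' : [\/ lt_code c c', perm_eq c c' | lt_code c' c].
Proof.
pose M := (\max_(n <- c ++ c') n).+1.
have out n : M <= n -> count_mem n c = count_mem n c'.
  move=> leMn; have nin : n \notin c ++ c'.
    by apply: contraL leMn => /mem_le_max; lia.
  by move: nin; rewrite mem_cat negb_or => /andP[/count_memPn -> /count_memPn ->].
elim: M out => [|M IH] out.
  by constructor 2; apply/allP => n _; apply/eqP/out.
have [ltM | gtM | eqM] := ltngtP (count_mem M c) (count_mem M c').
- by constructor 1; exists M.
- by constructor 3; exists M => // m /out.
by apply: IH => n; rewrite leq_eqVlt => /orP[/eqP <- //|/out].
Qed.

Lemma lt_code_cons n c c' : lt_code c c' -> lt_code (n :: c) (n :: c').
Proof.
by move=> [k ltk eqk]; exists k => [|m /eqk] /=; rewrite ?ltn_add2l // => ->.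
Qed.

(** Only variables in the image of [shift s] occur after renaming, and their
order is preserved. *)
Lemma lt_code_shift s c c' : increasing s ->
  lt_code c c' -> lt_code (map (shift s) c) (map (shift s) c').
Proof.
move=> incs [k ltk eqk]; have inj := shift_inj incs.
have cnt d n : count_mem (shift s n) (map (shift s) d) = count_mem n d.
  by rewrite count_map; apply: eq_count => m /=; rewrite (inj_eq inj).
exists (shift s k) => [|m ltm]; first by rewrite !cnt.
have [[n eqm] | nim] := EM (exists n, m = shift s n).
  rewrite eqm !cnt; apply: eqk; rewrite ltnNge; apply/negP => le_nk.
  move: ltm; rewrite eqm ltnNge; case/negP.
  move: le_nk; rewrite leq_eqVlt => /orP[/eqP->//|/(increasing_shift incs)/ltnW//].
by rewrite !(count_memPn _) //; apply/mapP => -[n _ eqm]; apply: nim; exists n.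
Qed.

(** By induction on a strict bound [n.+1] for the variables that occur: a
descent either lowers the multiplicity of [n], or keeps it and lowers the part
below [n], which is accessible by the induction hypothesis. *)
Lemma lt_code_wf : well_founded lt_code.
Proof.
suff acc n c : (forall m, n <= m -> count_mem m c = 0) -> Acc lt_code c.
  move=> c; apply: (acc (\max_(n <- c) n).+1) => m ltm; apply/count_memPn.
  by apply: contraL ltm => /mem_le_max; lia.
elim: n c => [|n IHn] c c_lt.
  by constructor=> c' [m]; rewrite c_lt.
have [v eqv] : exists v, count_mem n c = v by eexists.
elim/ltn_ind: v c c_lt eqv => v IHv c c_lt eqv.
have cnt m d :
    count_mem m (filter (ltn^~ n) d) = if m < n then count_mem m d else 0.
  rewrite count_filter; case: ifP => ltm.
    by apply: eq_count => k /=; case: eqP => // ->.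
  by rewrite -(count_pred0 d); apply: eq_count => k /=; case: eqP => // ->.
have : Acc lt_code (filter (ltn^~ n) c).
  by apply: IHn => m le_nm; rewrite cnt ltnNge le_nm.
move eqa: (filter _ c) => a acca; elim: acca c eqa c_lt eqv => {}a _ IHa c eqa c_lt eqv.
constructor=> c' [k ltk eqk].
have [lt_nk | lt_kn | eq_kn] := ltngtP n k.
- by rewrite c_lt in ltk.
- apply: (IHa (filter (ltn^~ n) c')) => //.
  + rewrite -eqa; exists k; first by rewrite !cnt lt_kn.
    by move=> m /eqk eqm; rewrite !cnt eqm.
  + by move=> m le_nm; rewrite eqk ?c_lt //; lia.
  + by rewrite eqk.
apply: (IHv (count_mem n c')) => //; first by rewrite -eqv eq_kn.
by move=> m le_nm; rewrite eqk ?c_lt //; lia.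
Qed.

(** * Monomials and their codes *)

(** The letter [(s, x)] is the generator [x] as a right child when [s] is true,
as a left child otherwise. *)
Definition attach (o : bool * generator) t :=
  if o.1 then Node t (Leaf o.2) else Node (Leaf o.2) t.

Definition attach_all ops t := foldr attach t ops.

Fixpoint leaves (s : bool) (t : magma generator) : seq (bool * generator) :=
  match t with
  | Leaf x => [:: (s, x)]
  | Node u v => leaves false u ++ leaves true v
  end.

(** The kind of a variable records its side and its parity. Within an index, a
generator standing alone has a larger code than the same generator as a child:
multiplying turns the former into the latter, and must not raise a lower term
above the leading one. *)
Definition leaf_code (o : bool * generator) := 6 * o.2.2 + (2 * o.1 + o.2.1).
Definition root_code (x : generator) := 6 * x.2 + (4 + x.1).

Definition codes (t : magma generator) : seq nat :=
  match t with
  | Leaf x => [:: root_code x]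
  | Node _ _ => map leaf_code (leaves false t)
  end.

Definition is_node (t : magma generator) := if t is Node _ _ then true else false.

Lemma leaf_code_inj : injective leaf_code.
Proof.
suff inj (s p s' p' : bool) (i i' : nat) :
    6 * i + (2 * s + p) = 6 * i' + (2 * s' + p') -> [/\ s = s', p = p' & i = i'].
  by move=> [s [p i]] [s' [p' i']] eqc; have [-> -> ->] := inj s p s' p' i i' eqc.
by case: s s' p p' => [] [] [] [] /= eqc; split=> //; lia.
Qed.

Lemma root_code_inj : injective root_code.
Proof.
suff inj (p p' : bool) (i i' : nat) :
    6 * i + (4 + p) = 6 * i' + (4 + p') -> p = p' /\ i = i'.
  by move=> [p i] [p' i'] eqc; have [-> ->] := inj p p' i i' eqc.
by case: p p' => [] [] /= eqc; split=> //; lia.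
Qed.

Lemma leaves_neq0 s t : leaves s t != [::].
Proof. by elim: t s => //= u IHu v _ _; case: leaves (IHu false). Qed.

Lemma size_codes_node t : is_node t -> 1 < size (codes t).
Proof.
case: t => // u v _; rewrite size_map size_cat.
by apply: (@leq_add 1 1); rewrite lt0n size_eq0 leaves_neq0.
Qed.

Lemma codes_attach o t : is_node t ->
  perm_eq (codes (attach o t)) (leaf_code o :: codes t).
Proof.
case: t o => // u v [[] x] _ /=; rewrite ?perm_refl //.
by rewrite cats1 map_rcons perm_rcons.
Qed.

Lemma is_node_attach_all ops t : is_node t -> is_node (attach_all ops t).
Proof. by elim: ops => [|[[] x] ops IH]. Qed.

Lemma codes_attach_all ops t : is_node t ->
  perm_eq (codes (attach_all ops t)) (map leaf_code ops ++ codes t).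
Proof.
move=> nt; elim: ops => //= o ops IH.
apply: perm_trans (codes_attach o (is_node_attach_all ops nt)) _.
by rewrite perm_cons.
Qed.

Local Open Scope ring_scope.

(** * Straightening *)

Section Identities.
Variable K : fieldType.

Definition graded (A : superalgebra K) (phi : generator -> A) :=
  forall x, homog x.1 (phi x).

(** For rearrangements of a monomial the scalar is a sign determined by the
parities of the generators. What matters is that it is nonzero and the same for
all algebras and substitutions. *)
Definition proportional (t t' : magma generator) := exists2 c : K, c != 0 &
  forall A : superalgebra K, bicommutative A -> forall phi : generator -> A,
  graded phi -> eval_monomial phi t = c *: eval_monomial phi t'.

Local Notation "t ~~> t'" := (proportional t t') (at level 70).

Lemma graded_eval (A : superalgebra K) (phi : generator -> A) t :
  graded phi -> homog (parity t) (eval_monomial phi t).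
Proof. by move=> gphi; elim: t => //= u IHu v IHv; apply: homogM. Qed.

Lemma proportional_refl t : t ~~> t.
Proof. by exists 1; rewrite ?oner_eq0 // => *; rewrite scale1r. Qed.
#[local] Hint Resolve proportional_refl : core.

Lemma proportional_trans t2 t1 t3 : t1 ~~> t2 -> t2 ~~> t3 -> t1 ~~> t3.
Proof.
move=> [c c0 e12] [d d0 e23]; exists (c * d); first by rewrite mulf_neq0.
by move=> A bA phi gphi; rewrite e12 // e23 // scalerA.
Qed.

Lemma proportional_sym t1 t2 : t1 ~~> t2 -> t2 ~~> t1.
Proof.
move=> [c c0 e]; exists c^-1; first by rewrite invr_eq0.
by move=> A bA phi gphi; rewrite e // scalerA mulVf // scale1r.
Qed.

Lemma proportional_node u u' v v' : u ~~> u' -> v ~~> v' -> Node u v ~~> Node u' v'.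
Proof.
move=> [c c0 eu] [d d0 ev]; exists (c * d); first by rewrite mulf_neq0.
by move=> A bA phi gphi /=; rewrite eu // ev // linearZl_LR linearZr_LR /= scalerA.
Qed.

Lemma swap_left a b c : Node a (Node b c) ~~> Node b (Node a c).
Proof.
exists ((-1) ^+ (parity a && parity b)); first by rewrite signr_eq0.
move=> A bA phi gphi.
by have [] := bA _ _ _ _ _ _
  (graded_eval a gphi) (graded_eval b gphi) (graded_eval c gphi).
Qed.

Lemma swap_right a b c : Node (Node a b) c ~~> Node (Node a c) b.
Proof.
exists ((-1) ^+ (parity b && parity c)); first by rewrite signr_eq0.
move=> A bA phi gphi.
by have [] := bA _ _ _ _ _ _
  (graded_eval a gphi) (graded_eval b gphi) (graded_eval c gphi).
Qed.

(** This uses that the inner factor is a product: [b] is exchanged with [d], the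
product [c b] is moved in front of [a], then [b] is moved out again. *)
Lemma swap_left_right a b c d :
  Node a (Node (Node c d) b) ~~> Node (Node a (Node c d)) b.
Proof.
apply: proportional_trans
  (proportional_node (proportional_refl a) (swap_right c d b)) _.
apply: (proportional_trans (swap_left _ _ _)).
apply: (proportional_trans (swap_right _ _ _)).
exact: proportional_node (swap_left _ _ _) (proportional_refl _).
Qed.

Lemma proportional_attach o t t' : t ~~> t' -> attach o t ~~> attach o t'.
Proof. by case: o => [[] x] tt'; apply: proportional_node. Qed.

Lemma proportional_attach_all ops t t' :
  t ~~> t' -> attach_all ops t ~~> attach_all ops t'.
Proof. by move=> tt'; elim: ops => //= o ops IH; apply: proportional_attach. Qed.

Lemma swap_attach o o' t : is_node t ->
  attach o (attach o' t) ~~> attach o' (attach o t).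
Proof.
case: t => // c d _; case: o o' => [[] x] [[] y].
- exact: swap_right.
- exact/proportional_sym/swap_left_right.
- exact: swap_left_right.
- exact: swap_left.
Qed.

Lemma attach_all_cat ops ops' t :
  attach_all (ops ++ ops') t = attach_all ops (attach_all ops' t).
Proof. exact: foldr_cat. Qed.

Lemma attach_all_rot ops o ops' t : is_node t ->
  attach_all (ops ++ o :: ops') t ~~> attach_all (o :: ops ++ ops') t.
Proof.
move=> nt; elim: ops => //= o' ops IH.
apply: (proportional_trans (proportional_attach o' IH)).
exact/swap_attach/is_node_attach_all.
Qed.

Lemma attach_all_perm ops ops' t : is_node t -> perm_eq ops ops' ->
  attach_all ops t ~~> attach_all ops' t.
Proof.
move=> nt; elim: ops ops' => [|o ops IH] ops' eq_ops.
  by have := perm_size eq_ops; case: ops' {eq_ops}.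
have o_in : o \in ops' by rewrite -(perm_mem eq_ops) mem_head.
case/splitPr: o_in eq_ops => p1 p2.
rewrite perm_sym perm_catC /= perm_cons perm_catC perm_sym => eq_ops.
apply: proportional_trans (proportional_sym (attach_all_rot _ _ _ nt)).
exact/proportional_attach/IH.
Qed.

(** The operators around a product may be permuted freely, but the innermost
letter acts on a single generator, where operators of different sides do not
commute. It can only be exchanged with a letter of the same side. *)
Lemma exchange_innermost s x x' y ops ops' :
  perm_eq ((s, x) :: ops) ((s, x') :: ops') ->
  attach_all ops (attach (s, x) (Leaf y)) ~~>
  attach_all ops' (attach (s, x') (Leaf y)).
Proof.
have node z : is_node (attach (s, z) (Leaf y)) by case: s.
have [<- | neq_x eq_ops] := eqVneq x x'.
  by rewrite perm_cons; apply: attach_all_perm.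
have x'_in : (s, x') \in ops.
  have := mem_head (s, x') ops'; rewrite -(perm_mem eq_ops) inE => /orP[/eqP[eqx]|//].
  by rewrite eqx eqxx in neq_x.
have eq_rem : perm_eq ops (rcons (rem (s, x') ops) (s, x')).
  by rewrite perm_sym perm_rcons perm_sym perm_to_rem.
have eq_ops' : perm_eq (rcons (rem (s, x') ops) (s, x)) ops'.
  rewrite -(perm_cons (s, x')) perm_sym -(permPl eq_ops) perm_sym -rcons_cons perm_rcons.
  by rewrite perm_cons perm_sym perm_to_rem.
apply: proportional_trans (attach_all_perm (node x) eq_rem) _.
apply: proportional_trans (attach_all_perm (node x') eq_ops').
rewrite -!cats1 !attach_all_cat /=; apply: proportional_attach_all.
by case: (s); [apply: swap_right | apply: swap_left].
Qed.

Lemma attach_all_product_perm x y ops x' y' ops' :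
  perm_eq ((false, x) :: (true, y) :: ops) ((false, x') :: (true, y') :: ops') ->
  attach_all ops (Node (Leaf x) (Leaf y)) ~~>
  attach_all ops' (Node (Leaf x') (Leaf y')).
Proof.
move=> eq_ops.
have x'_in : (false, x') \in (false, x) :: ops.
  have := mem_head (false, x') ((true, y') :: ops').
  by rewrite -(perm_mem eq_ops) !inE.
have eq_rem := perm_to_rem x'_in.
apply: proportional_trans (exchange_innermost y eq_rem) _.
apply: (exchange_innermost (s := true)).
apply/permP => p; have := permP eq_ops p; have := permP eq_rem p.
by rewrite /=; lia.
Qed.

(** Multiplication by a monomial is a composition of multiplications by its
leaves, since [(c d) e] and [(c e) d] are proportional, as well as [e (c d)] and
[c (e d)]. The operator that acts first keeps the side [s]. *)
Lemma place_attach s u : exists x ops, perm_eq ((s, x) :: ops) (leaves s u) /\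
  forall e, (if s then Node e u else Node u e) ~~> attach_all ops (attach (s, x) e).
Proof.
elim: u s => [x | c IHc d IHd] s; first by exists x, [::]; case: s.
have [x [o1 [p1 e1]]] := IHc false; have [y [o2 [p2 e2]]] := IHd true.
case: s.
  exists y, (o1 ++ (false, x) :: o2); split.
    apply/permP => p; have := permP p1 p; have := permP p2 p.
    by rewrite /= !count_cat /=; lia.
  move=> e; apply: (proportional_trans (swap_left _ _ _)).
  apply: (proportional_trans (e1 _)); rewrite attach_all_cat.
  by apply: proportional_attach_all; apply: proportional_attach.
exists x, (o2 ++ (true, y) :: o1); split.
  apply/permP => p; have := permP p1 p; have := permP p2 p.
  by rewrite /= !count_cat /=; lia.
move=> e; apply: (proportional_trans (swap_right _ _ _)).
apply: (proportional_trans (e2 _)); rewrite attach_all_cat.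
by apply: proportional_attach_all; apply: proportional_attach.
Qed.

(** The normal form: a product of two generators, surrounded by operators. *)
Lemma node_normal t : is_node t -> exists x y ops,
  perm_eq ((false, x) :: (true, y) :: ops) (leaves false t) /\
  t ~~> attach_all ops (Node (Leaf x) (Leaf y)).
Proof.
case: t => // u v _; have [x [o1 [p1 e1]]] := place_attach false u.
have [y [o2 [p2 e2]]] := place_attach true v.
exists x, y, (o1 ++ o2); split.
  apply/permP => p; have := permP p1 p; have := permP p2 p.
  by rewrite /= !count_cat /=; lia.
apply: proportional_trans (e1 v) _; rewrite attach_all_cat.
exact/proportional_attach_all/e2.
Qed.

Theorem straightening t t' : perm_eq (codes t) (codes t') -> t ~~> t'.
Proof.
move=> eq_tt'; have [nt | ] := boolP (is_node t); last first.
  case: t eq_tt' => // x eq_xt' _; case: t' eq_xt' => [y|u v] eq_xt'.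
    have := perm_mem eq_xt' (root_code x).
    by rewrite !inE eqxx => /esym/eqP/root_code_inj ->.
  by have := @size_codes_node (Node u v) isT; rewrite -(perm_size eq_xt').
have nt' : is_node t'.
  by have := size_codes_node nt; rewrite (perm_size eq_tt'); case: (t').
have {}eq_tt' : perm_eq (leaves false t) (leaves false t').
  apply: (perm_map_inj leaf_code_inj).
  by case: t t' nt nt' eq_tt' => [?|? ?] [?|? ?].
have [x [y [ops [eq_t e]]]] := node_normal nt.
have [x' [y' [ops' [eq_t' e']]]] := node_normal nt'.
apply: proportional_trans e (proportional_trans _ (proportional_sym e')).
apply: attach_all_product_perm; rewrite (permPl eq_t) (permPl eq_tt') perm_sym //.
Qed.

(** * Leading monomials *)

Definition combination (A : superalgebra K) (phi : generator -> A) s : A :=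
  \sum_(p <- s : seq (K * magma generator)) p.1 *: eval_monomial phi p.2.

Definition below t (s : seq (K * magma generator)) :=
  forall p, p \in s -> lt_code (codes p.2) (codes t).

(** The leading coefficient [c] may be zero, in which case [f] only involves
monomials below [t]. The expansion is required modulo the identities of
bicommutative superalgebras, so no basis of the free one is needed. *)
Definition has_lead (f : super_identity K) t c := exists2 s, below t s &
  forall A : superalgebra K, bicommutative A -> forall phi : generator -> A,
  graded phi -> eval phi f = c *: eval_monomial phi t + combination phi s.

Lemma combination_scale (A : superalgebra K) (phi : generator -> A) (a : K) s :
  combination phi [seq (a * p.1, p.2) | p <- s] = a *: combination phi s.
Proof.
by rewrite /combination big_map scaler_sumr; apply: eq_bigr => p _; rewrite scalerA.
Qed.

Lemma combination_cat (A : superalgebra K) (phi : generator -> A) s s' :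
  combination phi (s ++ s') = combination phi s + combination phi s'.
Proof. exact: big_cat. Qed.

Lemma combination_cons (A : superalgebra K) (phi : generator -> A) p s :
  combination phi (p :: s) = p.1 *: eval_monomial phi p.2 + combination phi s.
Proof. exact: big_cons. Qed.

(** Terms with proportional monomials are merged into one. *)
Lemma combination_lead s : s = [::] \/
  exists t c s', [/\ t \in map snd s, below t s' &
    forall A : superalgebra K, bicommutative A -> forall phi : generator -> A,
    graded phi ->
    combination phi s = c *: eval_monomial phi t + combination phi s'].
Proof.
elim: s => [|[a u] s [-> | [t [c [s' [ts lts' e]]]]]]; [by left | right | right].
  exists u, a, [::]; rewrite mem_head; split=> // A _ phi _.
  by rewrite combination_cons.
have [ltut | eq_ut | lttu] := lt_code_total (codes u) (codes t).
- exists t, c, ((a, u) :: s'); split; first by rewrite inE ts orbT.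
    by move=> p; rewrite inE => /orP[/eqP -> // | /lts'].
  move=> A bA phi gphi; rewrite !combination_cons /=.
  by rewrite e // addrCA.
- have [d _ ed] := straightening eq_ut.
  exists t, (a * d + c), s'; split; rewrite ?inE ?ts ?orbT //.
  move=> A bA phi gphi; rewrite !combination_cons /=.
  by rewrite e // ed // scalerA addrA -scalerDl.
exists u, a, ((c, t) :: s'); split; first by rewrite mem_head.
  by move=> p; rewrite inE => /orP[/eqP -> // | /lts' ltp]; apply: lt_code_trans lttu.
move=> A bA phi gphi; rewrite /combination !big_cons /=.
by rewrite -/(combination phi s) e.
Qed.

Lemma has_lead_sub f g t c d a : has_lead f t c -> has_lead g t d ->
  has_lead (f - a *: g) t (c - a * d).
Proof.
move=> [s lts ef] [s' lts' eg]; exists (s ++ [seq (- a * p.1, p.2) | p <- s']).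
  by move=> p; rewrite mem_cat => /orP[/lts // | /mapP[q /lts' ltq ->]].
move=> A bA phi gphi; rewrite evalB evalZ ef // eg //.
rewrite combination_cat combination_scale.
by rewrite scalerDr scalerBl scalerA opprD scaleNr addrACA.
Qed.

Lemma has_lead_perm f t t' c :
  perm_eq (codes t) (codes t') -> c != 0 -> has_lead f t c ->
  exists2 c', c' != 0 & has_lead f t' c'.
Proof.
move=> eq_tt' c0 [s lts ef]; have [d d0 ed] := straightening eq_tt'.
exists (c * d); first by rewrite mulf_neq0.
exists s; first by move=> p /lts; apply: lt_code_permr.
by move=> A bA phi gphi; rewrite ef // ed // scalerA.
Qed.

(** * Consequences with a prescribed leading monomial *)

Definition attach_identity o (f : super_identity K) : super_identity K :=
  if o.1 then smul f (gen K o.2) else smul (gen K o.2) f.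

Lemma satisfies_attach (A : superalgebra K) o f :
  satisfies A f -> satisfies A (attach_identity o f).
Proof.
case: o => [s x] sf phi gphi; have f0 := sf phi gphi.
rewrite /attach_identity /=; case: ifP => _; rewrite evalM f0.
  by rewrite linear0l.
by rewrite linear0r.
Qed.

Lemma leaf_code_notin_root x t : is_node t -> root_code x \notin codes t.
Proof.
case: t => // u v _; apply/mapP => -[[s [p i]] _].
by rewrite /leaf_code /root_code /=; case: x s p => [[] j] [] []; lia.
Qed.

(** When [u] is a single generator, multiplying replaces its code by a smaller
one, while [t], having no code of this kind, exceeds it by a larger variable. *)
Lemma lt_codes_attach o u t : is_node t -> lt_code (codes u) (codes t) ->
  lt_code (codes (attach o u)) (codes (attach o t)).
Proof.
move=> nt lt_ut; apply: lt_code_permr (_ : lt_code _ (leaf_code o :: codes t)).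
  by rewrite perm_sym codes_attach.
have [nu | ] := boolP (is_node u).
  apply: lt_code_perml (lt_code_cons (leaf_code o) lt_ut).
  by rewrite perm_sym codes_attach.
case: u lt_ut => // x [n ltn eqn] _.
have root_t := count_memPn (leaf_code_notin_root x nt).
(* No root code occurs in [codes t], so the comparison is decided above that
   of [x]. *)
have lt_rn : (root_code x < n)%N.
  rewrite ltnNge leq_eqVlt; apply/negP => /orP[/eqP n_root | /eqn].
    by rewrite n_root root_t in ltn.
  by rewrite root_t /= eqxx.
have lt_leaf (s : bool) : lt_code [:: leaf_code (s, x)] (codes t).
  have lt_sn m : (n <= m)%N -> leaf_code (s, x) == m = false.
    move=> le_nm; apply/negP => /eqP eqm; move: lt_rn; rewrite ltnNge; case/negP.
    by rewrite (leq_trans le_nm) // -eqm /leaf_code /root_code /=; case: s {eqm}; lia.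
  exists n => [|m ltm]; first by rewrite /= lt_sn // addn0 (leq_trans _ ltn).
  rewrite -(eqn m ltm) /= (lt_sn _ (ltnW ltm)); case: eqP => // eqm.
  by move: ltm; rewrite -eqm ltnNge (ltnW lt_rn).
case: o => [[] y] /=.
  apply: lt_code_perml (lt_code_cons _ (lt_leaf false)).
  exact: (permEl (perm_catC [:: _] [:: _])).
exact: lt_code_cons (lt_leaf true).
Qed.

Lemma has_lead_attach o f t c : is_node t -> has_lead f t c ->
  has_lead (attach_identity o f) (attach o t) c.
Proof.
move=> nt [s lts ef]; exists [seq (p.1, attach o p.2) | p <- s].
  by move=> p /mapP[q /lts ltq ->]; apply: lt_codes_attach.
move=> A bA phi gphi; rewrite /combination big_map /attach_identity /attach.
case: o => [[] x] /=; rewrite evalM eval_gen ef //.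
  rewrite linearDl linearZl_LR linear_sumlz; congr (_ + _).
  by apply: eq_bigr => p _; rewrite linearZl_LR.
rewrite linearDr linearZr_LR linear_sumr; congr (_ + _).
by apply: eq_bigr => p _; rewrite linearZr_LR.
Qed.

Fixpoint relabel (s : nat -> nat) (t : magma generator) : magma generator :=
  match t with
  | Leaf x => Leaf ((x.1, s x.2) : generator)
  | Node u v => Node (relabel s u) (relabel s v)
  end.

Definition relabel_identity s (f : super_identity K) : super_identity K :=
  eval (fun x => gen K (x.1, s x.2)) f.

Lemma eval_relabel_monomial (A : superalgebra K) (phi : generator -> A) s t :
  eval_monomial phi (relabel s t) = eval_monomial (fun x => phi (x.1, s x.2)) t.
Proof. by elim: t => //= u -> v ->. Qed.

Lemma eval_relabel (A : superalgebra K) (phi : generator -> A) s f :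
  eval phi (relabel_identity s f) = eval (fun x => phi (x.1, s x.2)) f.
Proof.
have eval_monomial_eval t : eval phi (eval_monomial (fun x => gen K (x.1, s x.2)) t) =
    eval_monomial (fun x => phi (x.1, s x.2)) t.
  elim: t => [x | u IHu v IHv] /=; first exact: eval_gen.
  by apply: etrans (evalM _ _ _) _; congr (smul _ _).
rewrite /relabel_identity /eval (linear_linext (linext (eval_monomial phi))).
exact: eq_linext.
Qed.

Lemma satisfies_relabel (A : superalgebra K) s f :
  satisfies A f -> satisfies A (relabel_identity s f).
Proof.
move=> sf phi gphi; rewrite eval_relabel; apply: sf => x.
exact: (gphi (x.1, s x.2)).
Qed.

Lemma leaves_relabel s b t :
  leaves b (relabel s t) = [seq (o.1, (o.2.1, s o.2.2)) | o <- leaves b t].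
Proof. by elim: t b => //= u IHu v IHv b; rewrite map_cat IHu IHv. Qed.

Lemma codes_relabel s t : codes (relabel s t) = map (shift s) (codes t).
Proof.
have shiftE i r : (r < 6)%N -> shift s (6 * i + r)%N = (6 * s i + r)%N.
  by move=> lt_r; rewrite /shift; congr (6 * s _ + _)%N; lia.
case: t => [x | u v].
  apply: (congr1 (fun n => [:: n])); rewrite /root_code shiftE //.
  by case: x.1.
rewrite /codes (leaves_relabel s false (Node u v)) -!map_comp.
apply: eq_map => o; rewrite /comp /leaf_code shiftE //.
by case: o.1 o.2.1 => [] [].
Qed.

Lemma has_lead_relabel s f t c : increasing s -> has_lead f t c ->
  has_lead (relabel_identity s f) (relabel s t) c.
Proof.
move=> incs [l ltl ef]; exists [seq (p.1, relabel s p.2) | p <- l].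
  by move=> p /mapP[q /ltl ltq ->]; rewrite !codes_relabel; apply: lt_code_shift.
move=> A bA phi gphi; rewrite eval_relabel ef //; last first.
  by move=> x; exact: (gphi (x.1, s x.2)).
rewrite eval_relabel_monomial /combination big_map; congr (_ + _).
by apply: eq_bigr => p _; rewrite eval_relabel_monomial.
Qed.

Lemma codes_leaves t n : is_node t -> n \in codes t -> exists o, n = leaf_code o.
Proof. by case: t => // u v _ /mapP[o _ ->]; exists o. Qed.

(** After renaming, the letters missing from [t] to reach [t'] are supplied by
multiplications by generators; a single generator only divides its renamings. *)
Lemma lead_transfer f t t' c : c != 0 -> has_lead f t c ->
  le_code (codes t) (codes t') ->
  exists2 g, (exists2 c', c' != 0 & has_lead g t' c') &
    forall A : superalgebra K, satisfies A f -> satisfies A g.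
Proof.
move=> c0 lead_f [s incs le_s].
have lead_sf := has_lead_relabel incs lead_f.
have sat_sf (A : superalgebra K) := @satisfies_relabel A s f.
have sub_s n : (count_mem n (codes (relabel s t)) <= count_mem n (codes t'))%N.
  have [|/count_memPn -> //] := boolP (n \in codes (relabel s t)).
  rewrite codes_relabel => /mapP[m _ ->]; apply: leq_trans (le_s m).
  by rewrite count_map; apply: sub_count => k /= /eqP/(shift_inj incs) ->.
have [l sub_l eq_l] := (count_subseqP _ _).1 sub_s.
have [d eq_d] := perm_to_subseq sub_l.
have {l sub_l eq_l eq_d} eq_t' : perm_eq (d ++ codes (relabel s t)) (codes t').
  apply/permP => p; have := permP eq_l p; have := permP eq_d p.
  by rewrite !count_cat; lia.
have [nt | leaf_t] := boolP (is_node t); last first.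
  have eq_codes : perm_eq (codes (relabel s t)) (codes t').
    case: t leaf_t {le_s lead_f lead_sf sub_s} eq_t' => // x _ /= eq_t'.
    have : root_code (x.1, s x.2) \in codes t'.
      by rewrite -(perm_mem eq_t') mem_cat mem_head orbT.
    case: t' eq_t' => [y _ /= | u v _]; first by rewrite inE => /eqP ->.
    by rewrite (negbTE (leaf_code_notin_root _ _)).
  exists (relabel_identity s f); last exact: sat_sf.
  exact: has_lead_perm eq_codes c0 lead_sf.
have nst : is_node (relabel s t) by case: (t) nt.
have nt' : is_node t'.
  move: (perm_size eq_t') (size_codes_node nst); rewrite size_cat.
  by case: (t') => //= x; lia.
have [ops eq_ops] : exists ops, d = map leaf_code ops.
  have : {subset d <= codes t'} by move=> n nd; rewrite -(perm_mem eq_t') mem_cat nd.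
  elim: (d) => [|n l IH] sub_l; first by exists [::].
  have [|o ->] := @codes_leaves t' n nt'; first exact/sub_l/mem_head.
  have [|ops ->] := IH; first by move=> m ml; apply: sub_l; rewrite inE ml orbT.
  by exists (o :: ops).
pose g := foldr attach_identity (relabel_identity s f) ops; exists g.
  apply: (has_lead_perm (t := attach_all ops (relabel s t)) _ c0).
    by apply: perm_trans eq_t'; rewrite eq_ops codes_attach_all.
  rewrite /g; elim: (ops) => //= o l IH; apply: has_lead_attach IH.
  exact: is_node_attach_all.
move=> A sat_f; rewrite /g; elim: (ops) => [|o l IH] /=; first exact: sat_sf.
exact: satisfies_attach.
Qed.

(** * Reduction and the finite basis *)

Lemma has_lead_identity f :
  (forall A : superalgebra K, bicommutative A -> satisfies A f) \/
  exists t c, has_lead f t c.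
Proof.
have ef (A : superalgebra K) (phi : generator -> A) :
  eval phi f = combination phi [seq (f@_t, t) | t <- msupp f].
  by rewrite /combination big_map.
have [s0 | [t [c [s [_ lts e]]]]] := combination_lead [seq (f@_t, t) | t <- msupp f].
  by left=> A bA phi gphi; rewrite ef s0 /combination big_nil.
by right; exists t, c, s => // A bA phi gphi; rewrite ef e.
Qed.

(** Well-founded induction on the leading monomial: subtracting a multiple of
[g] cancels the leading term of [f], and the difference is again in [I]. *)
Lemma lead_reduction (I : super_identity K -> Prop) (A : superalgebra K) :
  bicommutative A ->
  (forall f g a, I f -> I g -> I (f - a *: g)) ->
  (forall f t c, c != 0 -> I f -> has_lead f t c -> exists g c',
    [/\ c' != 0, I g, satisfies A g & has_lead g t c']) ->
  forall f, I f -> satisfies A f.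
Proof.
move=> bA IB Ilead.
have reduce t : forall f c, I f -> has_lead f t c -> satisfies A f.
  move codes_t: (codes t) => k; elim/(well_founded_ind lt_code_wf): k t codes_t.
  move=> k IH t codes_t; subst k.
  have zero f : I f -> has_lead f t 0 -> satisfies A f.
    move=> If [s lts ef]; have [s0 | [u [c [s' [us lts' e]]]]] := combination_lead s.
      by move=> phi gphi; rewrite ef // s0 /combination big_nil scale0r addr0.
    have lt_ut : lt_code (codes u) (codes t) by case/mapP: us => p /lts ltp ->.
    apply: (IH _ lt_ut u erefl f c If); exists s' => // B bB phi gphi.
    by rewrite ef // scale0r add0r e.
  move=> f c If lead_f; have [c0 | c_neq0] := eqVneq c 0.
    by apply: zero If _; rewrite -c0.
  have [g [c' [c'0 Ig sat_g lead_g]]] := Ilead f t c c_neq0 If lead_f.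
  have sat_fg : satisfies A (f - (c / c') *: g).
    apply: zero (IB _ _ _ If Ig) _.
    by have := has_lead_sub (c / c') lead_f lead_g; rewrite divfK // subrr.
  move=> phi gphi; have := sat_fg phi gphi.
  by rewrite evalB evalZ (sat_g phi gphi) scaler0 subr0.
move=> f If; have [/(_ A bA) // | [t [c]]] := has_lead_identity f; exact: reduce If.
Qed.

Lemma bicommutative_of_identities (A : superalgebra K) :
  (forall i j k, satisfies A (left_bicomm_identity K i j k)) ->
  (forall i j k, satisfies A (right_bicomm_identity K i j k)) ->
  bicommutative A.
Proof.
move=> satL satR i j k x1 x2 x3 h1 h2 h3.
pose phi (x : generator) : A :=
  if x == (i, 0%N) then x1 else if x == (j, 1%N) then x2 else
  if x == (k, 2%N) then x3 else 0.
have gphi : graded phi.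
  by move=> x; rewrite /phi; do 3!case: eqP => [-> //|_]; apply: homog0.
split; apply: subr0_eq.
  by have := satL i j k phi gphi; rewrite eval_left_bicomm /phi /= !xpair_eqE !eqxx !andbF.
by have := satR i j k phi gphi; rewrite eval_right_bicomm /phi /= !xpair_eqE !eqxx !andbF.
Qed.

End Identities.

Theorem theorem5p6 (K : fieldType) (hK : 2%N \notin [pchar K]) :
  specht_property (@bicommutative K).
Proof.
move=> V [S VS] Vbicomm; pose I f := forall A, V A -> satisfies A f.
have [leads leadsP leads_basis] := le_code_finite_basis
  (fun p : magma generator * super_identity K => codes p.1)
  (fun p => I p.2 /\ exists2 c, c != 0 & has_lead p.2 p.1 c).
pose triples := [seq (i, jk) | i <- [:: false; true],
  jk <- [seq (j, k) | j <- [:: false; true], k <- [:: false; true]]].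
have in_triples i j k : (i, (j, k)) \in triples by case: i j k => [] [] [].
exists ([seq left_bicomm_identity K p.1 p.2.1 p.2.2 | p <- triples] ++
  [seq right_bicomm_identity K p.1 p.2.1 p.2.2 | p <- triples] ++ map snd leads).
move=> A; split=> [VA f | satA].
  rewrite !mem_cat => /or3P[] /mapP[p p_in ->] phi gphi.
  - have [e _] := Vbicomm A VA _ _ _ _ _ _
      (gphi (p.1, 0%N)) (gphi (p.2.1, 1%N)) (gphi (p.2.2, 2%N)).
    by rewrite eval_left_bicomm e subrr.
  - have [_ e] := Vbicomm A VA _ _ _ _ _ _
      (gphi (p.1, 0%N)) (gphi (p.2.1, 1%N)) (gphi (p.2.2, 2%N)).
    by rewrite eval_right_bicomm e subrr.
  by have [If _] := leadsP _ p_in; apply: If.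
have bA : bicommutative A.
  apply: bicommutative_of_identities => i j k; apply: satA; rewrite !mem_cat.
    by apply/orP; left; apply/mapP; exists (i, (j, k)).
  by apply/orP; right; apply/orP; left; apply/mapP; exists (i, (j, k)).
apply/VS => f Sf.
have If : I f by move=> B /VS; apply.
apply: lead_reduction If => // [g h a Ig Ih B VB phi gphi | g t c c0 Ig lead_g].
  by rewrite evalB evalZ (Ig B VB phi gphi) (Ih B VB phi gphi) scaler0 subr0.
have [[u h] uh_in /= le_ut] : exists2 p, p \in leads & le_code (codes p.1) (codes t).
  by apply: (leads_basis (t, g)); split=> //; exists c.
have [/= Ih [d d0 lead_h]] := leadsP _ uh_in.
have [h' [c' c'0 lead_h'] sat_h'] := lead_transfer d0 lead_h le_ut.
exists h', c'; split=> //; first by move=> B VB; apply/sat_h'/Ih.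
apply: sat_h'; apply: satA; rewrite !mem_cat; apply/orP; right; apply/orP; right.
by apply/mapP; exists (u, h).
Qed.
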